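(* Let $\Omega$ be a bounded domain in $\mathbb{C}$ whose boundary consists of a finite number of disjoint Jordan curves. Let $V_0,V_1,\dots,V_{n-1}$ be the connected components of $\widehat{\mathbb{C}}\setminus\Omega$, with $\infty\in V_0$, let $I=\{0,1,\dots,n-1\}$, $\Omega_i=\widehat{\mathbb{C}}\setminus V_i$, and let $\phi_i:\overline{D}\to\overline{\Omega_i}$ $(i\in I)$ be Riemann maps (extended homeomorphically to the closures). For each $i\in I$ let $J_i\subset\partial\Omega_i$ be relatively open, with $J_i\ne\partial\Omega_i$ for at least one $i\in I$, and put $L_i=\phi_i^{-1}(J_i)\subset\partial D$ and $J=J_0\cup J_1\cup\dots\cup J_{n-1}$. For $i\in I$ and $m\in\mathbb{N}$ let $\Delta^{(i)}_m=\{z\in\Omega_i\cup J_i:\operatorname{dist}(z,\partial\Omega_i\setminus J_i)\ge\frac1m\}$, with the convention $\Delta_m^{(i)}=\overline{\Omega_i}$ if $\partial\Omega_i\setminus J_i=\emptyset$, and let $L^{(i)}_m=\phi_i^{-1}(\Delta^{(i)}_m\cap J_i)$. For $i\in I$ and $k,m\in\mathbb{N}$ let $$D^{(i)}_{k,m}=\Big\{u\in C(L_i):\ \text{for all }\theta\in L^{(i)}_m\text{ there exists }y\in\big(\theta-\tfrac1k,\theta+\tfrac1k\big)\cap L^{(i)}_m\text{ such that }|u(y)-u(\theta)|>k|y-\theta|\Big\},$$ $$E^{(i)}_{k,m}=\big\{f\in A(\Omega,J):\ \operatorname{Re}(f\circ\phi_i)|_{L_i}\in D^{(i)}_{k,m}\big\}.$$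 Then the set $S=\bigcap_{i=0}^{n-1}\bigcap_{k,m=1}^{\infty}E^{(i)}_{k,m}$ is dense in $A(\Omega,J)$.
   Context: $\widehat{\mathbb{C}}=\mathbb{C}\cup\{\infty\}$ and $D$ is the open unit disc. $A(\Omega,J)$ is the set of holomorphic functions $f:\Omega\to\mathbb{C}$ which can be extended continuously to $\Omega\cup J$ (the extension is also denoted $f$), with the Fréchet topology induced by the seminorms $\sup_{z\in\Delta_m}|f(z)|$, $m=1,2,\dots$, where $\Delta_m=\bigcap_{i\in I}\Delta_m^{(i)}$. By abuse of notation, a function $u$ on a subset $L$ of the unit circle is identified with the $2\pi$-periodic function $y\mapsto u(e^{iy})$ on the corresponding subset of $\mathbb{R}$ (also denoted $L$), and one writes $u(y)$ for $u(e^{iy})$; in the definition of $D^{(i)}_{k,m}$, $\theta$ and $y$ are real parameters in this sense. $C(L_i)$ denotes the set of continuous functions on $L_i$.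
   Formalization: The formal theorem additionally assumes that no set L_m^(i) (m ≥ 1) has an isolated point; without this S is empty and the claim fails, e.g. for the disc with J_0 = {w : |w−1| < 1/M}, where L_M = {1}. *)

(* Defs.v *)
From HB Require Import structures.
From mathcomp Require Import all_boot all_order all_algebra.
From mathcomp Require Import all_classical all_reals all_analysis.
From mathcomp.real_closed Require Import complex.

Set Implicit Arguments.
Unset Strict Implicit.
Unset Printing Implicit Defensive.

Import Order.TTheory GRing.Theory Num.Theory.
Import numFieldNormedType.Exports.

Local Open Scope classical_set_scope.
Local Open Scope ring_scope.

(* The library puts the norm topology on abstract number fields only; this
   transports it to the concrete type R[i]. The scalar field is R[i] itself, so
   that [derivable f z 1] is complex differentiability at z. *)
HB.instance Definition _ (R : realType) := GRing.ComAlgebra.copy R[i] R[i]^o.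
HB.instance Definition _ (R : realType) := Vector.copy R[i] R[i]^o.
HB.instance Definition _ (R : realType) := NormedModule.copy R[i] R[i]^o.

(* The Riemann sphere; the point at infinity is [None]. *)
Notation sphere R := (one_point_compactification R[i]).

Definition boundary {T : topologicalType} (A : set T) : set T :=
  closure A `\` interior A.

Definition components {T : topologicalType} (A : set T) : set (set T) :=
  connected_component A @` A.

Definition relatively_open {T : topologicalType} (X A : set T) : Prop :=
  exists2 O : set T, open O & A = O `&` X.

Definition homeomorphism {T U : topologicalType} (A : set T) (B : set U)
    (f : T -> U) (g : U -> T) : Prop :=
  [/\ set_fun A B f, set_fun B A g,
      (forall x, A x -> g (f x) = x) /\ (forall y, B y -> f (g y) = y),
      {within A, continuous f} & {within B, continuous g}].

Section complex_plane.
Variable R : realType.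

Definition unit_disc : set R[i] := [set w | Normc.normc w < 1].
Definition closed_unit_disc : set R[i] := [set w | Normc.normc w <= 1].
Definition unit_circle : set R[i] := [set w | Normc.normc w = 1].

Definition expi (y : R) : R[i] := (cos y +i* sin y)%C.

Definition is_domain (W : set R[i]) : Prop :=
  [/\ W !=set0, open W & connected W].

Definition is_jordan_curve (G : set R[i]) : Prop :=
  exists g : R[i] -> R[i],
    [/\ {within unit_circle, continuous g}, {in unit_circle &, injective g}
      & g @` unit_circle = G].

Definition bounded_by_jordan_curves (W : set R[i]) : Prop :=
  exists (N : nat) (G : 'I_N -> set R[i]),
    [/\ forall j, is_jordan_curve (G j), trivIset setT G
      & boundary W = \bigcup_j G j].

Definition to_sphere (B : set R[i]) : set (sphere R) := Some @` B.

Definition plane_part (B : set (sphere R)) : set R[i] := [set z | B (Some z)].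

(* Holomorphy with values in, or defined on, the sphere is expressed with the
   chart z on the plane and the chart 1/z around infinity. *)
Definition finite_part (p : sphere R) : R[i] := if p is Some z then z else 0.

Definition sphere_inv (p : sphere R) : sphere R :=
  if p is Some z then (if z == 0 then None else Some z^-1) else Some 0.

Definition holomorphic_to_sphere (phi : R[i] -> sphere R) (w : R[i]) : Prop :=
  {for w, continuous phi} /\
  if phi w is Some _ then derivable (finite_part \o phi) w 1
  else derivable (finite_part \o sphere_inv \o phi) w 1.

Definition holomorphic_from_sphere (psi : sphere R -> R[i]) (p : sphere R) :
    Prop :=
  if p is Some z then derivable (fun z' => psi (Some z')) z 1
  else derivable (fun z' => psi (sphere_inv (Some z'))) 0 1.

(* Biholomorphisms of the disc onto W together with their homeomorphic
   extension to the closures. Only the values of phi on the closed disc matter. *)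
Definition is_riemann_map (W : set (sphere R)) (phi : R[i] -> sphere R) :
    Prop :=
  exists psi : sphere R -> R[i],
    [/\ homeomorphism closed_unit_disc (closure W) phi psi,
        phi @` unit_disc = W,
        (forall w, unit_disc w -> holomorphic_to_sphere phi w)
      & forall p, W p -> holomorphic_from_sphere psi p].

(* Euclidean distance, infinite between a point of the plane and infinity. *)
Definition edistC (p q : sphere R) : \bar R :=
  match p, q with
  | Some z, Some w => (Normc.normc (z - w))%:E
  | None, None => 0%E
  | _, _ => +oo%E
  end.

Definition dist_to (p : sphere R) (B : set (sphere R)) : \bar R :=
  ereal_inf (edistC p @` B).

Definition Delta_comp (Wi Ji : set (sphere R)) (m : nat) : set (sphere R) :=
  if pselect (boundary Wi `\` Ji = set0) then closure Wi
  else [set p | (Wi `|` Ji) p /\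
                ((m%:R^-1)%:E <= dist_to p (boundary Wi `\` Ji))%E].

Definition L_arc (phi : R[i] -> sphere R) (Ji : set (sphere R)) : set R[i] :=
  [set w | closed_unit_disc w /\ Ji (phi w)].

(* This set can have isolated points: for the disc, phi = Some and J the open
   arc of those w with `|w - 1| < 1 / m, it is the single point 1. *)
Definition L_level (phi : R[i] -> sphere R) (Wi Ji : set (sphere R))
    (m : nat) : set R[i] :=
  [set w | closed_unit_disc w /\ (Delta_comp Wi Ji m `&` Ji) (phi w)].

(* A function u on a subset of the unit circle is handled through a total
   function u : R[i] -> R whose other values are never looked at;
   [u (expi y)] is the "u(y)" of the 2 pi-periodic point of view. *)
Definition D_class (L Lm : set R[i]) (k : nat) : set (R[i] -> R) :=
  [set u | {within L, continuous u} /\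
    forall theta : R, Lm (expi theta) ->
      exists y : R,
        [/\ theta - k%:R^-1 < y < theta + k%:R^-1, Lm (expi y)
          & k%:R * `|y - theta| < `|u (expi y) - u (expi theta)|]].

(* An element of A(W, J) is given by its extension to W `|` J, which is unique
   when J is contained in the closure of W, prolonged by 0 to make it a total
   function. *)
Definition A_space (W J : set R[i]) : set (R[i] -> R[i]) :=
  [set f | [/\ forall z, W z -> derivable f z 1,
               {within W `|` J, continuous f}
             & forall z, ~ (W `|` J) z -> f z = 0]].

Definition E_class (W J : set R[i]) (phi : R[i] -> sphere R)
    (Wi Ji : set (sphere R)) (k m : nat) : set (R[i] -> R[i]) :=
  [set f | A_space W J f /\
    D_class (L_arc phi Ji) (L_level phi Wi Ji m) k
      (fun w => complex.Re (f (finite_part (phi w))))].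

Definition sup_seminorm (K : set R[i]) (f : R[i] -> R[i]) : R :=
  sup [set Normc.normc (f z) | z in K].

(* Open subsets of A, and density in A, for the topology induced on A by the
   seminorms p 1, p 2, ... *)
Definition seminorm_open (A : set (R[i] -> R[i]))
    (p : nat -> (R[i] -> R[i]) -> R) (U : set (R[i] -> R[i])) : Prop :=
  U `<=` A /\
  forall f, U f -> exists N : nat, exists2 e : R, 0 < e &
    forall g, A g -> (forall m, (0 < m <= N)%N -> p m (g - f) < e) -> U g.

Definition seminorm_dense (A : set (R[i] -> R[i]))
    (p : nat -> (R[i] -> R[i]) -> R) (S : set (R[i] -> R[i])) : Prop :=
  S `<=` A /\
  forall U, seminorm_open A p U -> U !=set0 -> U `&` S !=set0.

End complex_plane.

(* Main.v *)
Require Import Defs.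
From HB Require Import structures.
From mathcomp Require Import all_boot all_order all_algebra.
From mathcomp Require Import all_classical all_reals all_analysis.
From mathcomp.real_closed Require Import complex.
From mathcomp Require Import ring lra.
Import Order.TTheory GRing.Theory Num.Theory.
Import numFieldNormedType.Exports.
Local Open Scope classical_set_scope.
Local Open Scope ring_scope.
Set Implicit Arguments.
Unset Strict Implicit.
Unset Printing Implicit Defensive.

Local Notation normc := Normc.normc.

(** Given [f] in A(Omega, J), the function that approximates it is
    [F = f + \sum_i G_i \o psi_i], where [psi_i] is the inverse of the Riemann
    map [phi_i] and the [G_i] are small elements of the disc algebra. On [L_i] the
    function [Re (F \o phi_i)] is [Re G_i] plus a continuous function about
    which nothing is known, since [phi_i] is merely a homeomorphism on the
    circle; the oscillations of [G_i] must therefore beat an arbitrary modulus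
    of continuity.

    This is possible for one slope [k] and one level set [K = L_m], compact and
    perfect in the circle, by a finite interpolation
    ([oscillating_perturbation]). Cover [K] by finitely many tiny balls centred
    at points [a] of [K], so small that the given function hardly varies on them,
    and choose in each a second point [b] of [K]. A disc algebra function [g]
    with [`|g| <= eps], close to [eps / 2] at each [a] and to 0 at each [b],
    makes the sum jump by almost [eps / 2] between [a] and [b]; so for every
    [theta] in [K] one of the neighbouring [a] and [b] is a witness of the
    failure of the [k]-Lipschitz bound. Bounding the real part alone would not
    do, because the conjugate function is not bounded in the sup norm; instead
    [g] is a sum of explicit peak functions ([peak_interpolation]).

    The witnesses survive perturbations of size [eps / 32], which replaces the
    Baire category argument by a sequence of perturbations with geometrically
    decreasing amplitudes that treats all triples (component, slope, level) one
    after the other ([generic_perturbation]). The limit is holomorphic because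
    the peak functions can also be taken small to second order on discs
    exhausting the open unit disc ([disc_algebra_limit]).

    The topology of the sphere enters only through three facts: the boundary of
    [~` V i] is contained in [V i] and avoids infinity, the maps [psi_i] are
    defined on all of Omega and J, and the level sets are compact. *)

(** * Modulus, continuity and complex derivative on the plane *)

Section Modulus.
Variable R : realType.
Implicit Types x y z w : R[i].

Lemma normE x : `|x| = (normc x)%:C%C.
Proof. by case: x. Qed.

Lemma normc_ge0 x : 0 <= normc x.
Proof. by case: x => a b; exact: sqrtr_ge0. Qed.

Lemma normcD x y : normc (x + y) <= normc x + normc y.
Proof. exact: le_normcD. Qed.

Lemma normc_opp x : normc (- x) = normc x.
Proof. exact: normcN. Qed.

Lemma normc_distC x y : normc (x - y) = normc (y - x).
Proof. by rewrite -normc_opp opprB. Qed.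

Lemma normcB x y : normc (x - y) <= normc x + normc y.
Proof. by rewrite -(normc_opp y) normcD. Qed.

Lemma normc_distD z x y : normc (x - y) <= normc (x - z) + normc (z - y).
Proof. by rewrite -[x - y](subrKA z) normcD. Qed.

Lemma normc_lbD x y : normc x - normc y <= normc (x + y).
Proof. by rewrite lerBlDr -{1}(addrK y x) normcB. Qed.

Lemma normc_real (a : R) : normc a%:C%C = `|a|.
Proof. by rewrite /= expr0n /= addr0 sqrtr_sqr. Qed.

Lemma normc_conj x : normc (x^*)%C = normc x.
Proof. by case: x => a b; rewrite /= sqrrN. Qed.

Lemma normc_Re x : `|complex.Re x| <= normc x.
Proof.
by case: x => a b; rewrite /= -sqrtr_sqr ler_wsqrtr // lerDl sqr_ge0.
Qed.

Lemma normc_Im x : `|complex.Im x| <= normc x.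
Proof.
by case: x => a b; rewrite /= -sqrtr_sqr ler_wsqrtr // lerDr sqr_ge0.
Qed.

Lemma normc_le_ReIm x : normc x <= `|complex.Re x| + `|complex.Im x|.
Proof.
case: x => a b /=; rewrite -[leRHS]ger0_norm ?addr_ge0 // -sqrtr_sqr.
rewrite ler_wsqrtr // sqrrD !real_normK ?num_real // -addrA lerD2l lerDr.
by rewrite mulrn_wge0 // mulr_ge0.
Qed.

Lemma ReB x y : complex.Re (x - y) = complex.Re x - complex.Re y.
Proof. by case: x => a b; case: y. Qed.

Lemma ReD x y : complex.Re (x + y) = complex.Re x + complex.Re y.
Proof. by case: x => a b; case: y. Qed.

Lemma ImB x y : complex.Im (x - y) = complex.Im x - complex.Im y.
Proof. by case: x => a b; case: y. Qed.

Lemma normc_gt0 x : (0 < normc x) = (x != 0).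
Proof.
rewrite lt_def normc_ge0 andbT; congr (~~ _).
by apply/eqP/eqP => [/Normc.eq0_normc //|->]; rewrite Normc.normc0.
Qed.

Lemma mul_conj_normc x : x * (x^*)%C = (normc x ^+ 2)%:C%C.
Proof. by rewrite -sqr_normc normE rmorphXn. Qed.

(** The norm of [R[i]] takes its values in [R[i]], so that balls have complex
    radii; the positive ones are exactly the positive reals. *)
Lemma nbhs_planeP x (A : set R[i]) :
  nbhs x A <-> exists2 d : R, 0 < d & forall y, normc (y - x) < d -> A y.
Proof.
split => [/nbhs_ballP[e /= e0 eA]|[d d0 dA]].
  case: e e0 eA => a b; rewrite ltcE /= => /andP[/eqP -> a0] eA.
  exists a => // y yx; apply: eA; rewrite -ball_normE /= distrC.
  by rewrite normE ltcR.
apply/nbhs_ballP; exists d%:C%C => /=; first by rewrite ltcR.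
by move=> y; rewrite -ball_normE /= distrC normE ltcR; exact: dA.
Qed.

Lemma within_planeP (A : set R[i]) (f : R[i] -> R[i]) :
  {within A, continuous f} <->
  forall x, A x -> forall e : R, 0 < e -> exists2 d : R, 0 < d &
    forall y, A y -> normc (y - x) < d -> normc (f y - f x) < e.
Proof.
rewrite subspace_continuousP; split => cf x Ax.
  move=> e e0; have : nbhs (f x) [set z | normc (z - f x) < e].
    by apply/nbhs_planeP; exists e.
  move=> /(cf x Ax) /nbhs_planeP[d d0 dA].
  by exists d => // y Ay yx; apply: dA.
move=> B /nbhs_planeP[e e0 eB]; have [d d0 dA] := cf x Ax e e0.
by apply/nbhs_planeP; exists d => // y yx Ay; exact/eB/dA.
Qed.

Lemma within_plane_realP (A : set R[i]) (u : R[i] -> R) :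
  {within A, continuous u} <->
  forall x, A x -> forall e : R, 0 < e -> exists2 d : R, 0 < d &
    forall y, A y -> normc (y - x) < d -> `|u y - u x| < e.
Proof.
rewrite subspace_continuousP; split => cf x Ax.
  move=> e e0; have : nbhs (u x) [set z | `|z - u x| < e].
    by apply/nbhs_ballP; exists e => // y; rewrite /ball /= distrC.
  move=> /(cf x Ax) /nbhs_planeP[d d0 dA].
  by exists d => // y Ay yx; apply: dA.
move=> B /nbhs_ballP[e /= e0 eB]; have [d d0 dA] := cf x Ax e e0.
apply/nbhs_planeP; exists d => // y yx Ay; apply: eB.
by rewrite /ball /= distrC; exact: dA.
Qed.

Lemma derivable_linP (f : R[i] -> R[i]) x :
  derivable f x 1 <-> exists D : R[i], forall e : R, 0 < e ->
    exists2 d : R, 0 < d & forall y, normc (y - x) < d ->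
      normc (f y - f x - D * (y - x)) <= e * normc (y - x).
Proof.
have quotE (D h : R[i]) : h != 0 ->
    h^-1 *: ((f \o shift x) (h *: (1 : R[i])) - f x) - D =
    h^-1 * (f (h + x) - f x - D * h).
  move=> h0; rewrite /= /shift /= -[h *: 1]/(h * 1) mulr1.
  rewrite -[h^-1 *: _]/(h^-1 * _).
  by rewrite [RHS]mulrBr [D * h]mulrC [h^-1 * (h * D)]mulrA mulVf // mul1r.
split=> [/cvg_ex[D /= fD]|[D fD]].
  exists D => e e0.
  have eD : nbhs D [set z | normc (z - D) < e] by apply/nbhs_planeP; exists e.
  have /nbhs_planeP[d d0 dP] := fD _ eD.
  exists d => // y yd; have [->|yx] := eqVneq y x.
    by rewrite !subrr mulr0 subr0 Normc.normc0 mulr0.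
  have yx0 : y - x != 0 by rewrite subr_eq0.
  have : normc ((y - x)^-1 *: ((f \o shift x) ((y - x) *: (1 : R[i])) - f x)
    - D) < e by apply: dP; rewrite ?subr0.
  rewrite quotE // subrK Normc.normcM Normc.normcV mulrC.
  by rewrite ltr_pdivrMr ?normc_gt0 // => /ltW.
apply/cvg_ex; exists D => /= A /nbhs_planeP[e e0 eA].
have e2 : 0 < e / 2 by rewrite divr_gt0.
have [d d0 dP] := fD _ e2.
apply/nbhs_planeP; exists d => // h; rewrite subr0 => hd h0; apply: eA => /=.
rewrite quotE // Normc.normcM Normc.normcV mulrC.
rewrite ltr_pdivrMr ?normc_gt0 //.
have := dP (h + x); rewrite addrK => /(_ hd) hB.
apply: (le_lt_trans hB); rewrite ltr_pM2r ?normc_gt0 //.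
by rewrite ltr_pdivrMr // ltr_pMr // ltr1n.
Qed.

Lemma derivable_quadratic (f : R[i] -> R[i]) x (D : R[i]) (B d : R) :
  0 < d ->
  (forall y, normc (y - x) < d ->
     normc (f y - f x - D * (y - x)) <= B * normc (y - x) ^+ 2) ->
  derivable f x 1.
Proof.
move=> d0 fD; apply/derivable_linP; exists D => e e0.
have B0 : 0 < `|B| + 1 by rewrite ltr_wpDl.
exists (Num.min d (e / (`|B| + 1))); first by rewrite lt_min d0 divr_gt0.
move=> y; rewrite lt_min => /andP[yd]; rewrite ltr_pdivlMr // => ye.
apply: (le_trans (fD y yd)); rewrite expr2 mulrA ler_wpM2r ?normc_ge0 //.
apply: le_trans (ltW ye); rewrite mulrC ler_wpM2l ?normc_ge0 //.
by rewrite (le_trans (ler_norm _)) // lerDl.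
Qed.

Lemma derivable_comp (f g : R[i] -> R[i]) (x : R[i]) :
  derivable f x 1 -> derivable g (f x) 1 -> derivable (g \o f) x 1.
Proof.
move=> /derivable_linP[D fD] /derivable_linP[E gE]; apply/derivable_linP.
exists (E * D) => e e0.
have D0 := normc_ge0 D; have E0 := normc_ge0 E.
have D1 : 0 < 2 * (normc D + 1) by lra.
have E1 : 0 < 2 * (normc E + 1) by lra.
have [r r0 rP] := gE _ (divr_gt0 e0 D1).
have [d1 d10 d1P] := fD 1 ltr01.
have [d2 d20 d2P] := fD _ (divr_gt0 e0 E1).
have r1 : 0 < r / (normc D + 1) by rewrite divr_gt0 //; lra.
exists (Num.min (r / (normc D + 1)) (Num.min d1 d2)).
  by rewrite !lt_min r1 d10.
move=> y; rewrite !lt_min => /and3P[yr y1 y2].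
have fy : normc (f y - f x) <= (normc D + 1) * normc (y - x).
  have := normcD (f y - f x - D * (y - x)) (D * (y - x)).
  rewrite subrK Normc.normcM; have := d1P y y1; rewrite mul1r.
  by rewrite mulrDl mul1r; lra.
have gy : normc (g (f y) - g (f x) - E * (f y - f x))
    <= e / 2 * normc (y - x).
  have fr : normc (f y - f x) < r.
    apply: (le_lt_trans fy); rewrite mulrC -ltr_pdivlMr //; lra.
  apply: (le_trans (rP _ fr)).
  have -> : e / 2 * normc (y - x) = e / (2 * (normc D + 1)) *
      ((normc D + 1) * normc (y - x)) by field; lra.
  by rewrite ler_wpM2l // ltW // divr_gt0.
have ey : normc E * normc (f y - f x - D * (y - x)) <= e / 2 * normc (y - x).
  apply: (@le_trans _ _ (normc E * (e / (2 * (normc E + 1)) * normc (y - x)))).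
    by rewrite ler_wpM2l // d2P.
  rewrite mulrA ler_wpM2r ?normc_ge0 //.
  have -> : normc E * (e / (2 * (normc E + 1))) =
      e / 2 * (normc E / (normc E + 1)) by field; lra.
  by rewrite ler_piMr ?divr_ge0 ?(ltW e0) // ler_pdivrMr ?mul1r; lra.
have -> : (g \o f) y - (g \o f) x - E * D * (y - x) =
    (g (f y) - g (f x) - E * (f y - f x)) + E * (f y - f x - D * (y - x)).
  by rewrite /=; ring.
apply: (le_trans (normcD _ _)); rewrite Normc.normcM; lra.
Qed.

End Modulus.

(** * Disc algebra and peak functions *)

Section Peaks.
Variable R : realType.
Implicit Types (a z w : R[i]) (g h : R[i] -> R[i]).

Definition disc_algebra g : Prop :=
  {within @closed_unit_disc R, continuous g} /\
  forall w, unit_disc w -> derivable g w 1.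

(** The constants add up under sums and pass to limits: such estimates stand in
    for the theorem of Weierstrass on uniform limits of holomorphic
    functions. *)
Definition taylor_bound (rho B : R) g : Prop :=
  forall w, normc w <= rho -> exists2 D : R[i], normc D <= B &
    forall z, normc z <= rho ->
      normc (g z - g w - D * (z - w)) <= B * normc (z - w) ^+ 2.

Lemma disc_algebra0 : disc_algebra 0.
Proof.
split; first by move=> x; exact: cvg_cst.
by move=> w _; exact: derivable_cst.
Qed.

Lemma disc_algebraD g h :
  disc_algebra g -> disc_algebra h -> disc_algebra (g + h).
Proof.
move=> [cg dg] [ch dh]; split.
  by move=> x; apply: cvgD; [exact: cg|exact: ch].
by move=> w Dw; apply: derivableD; [exact: dg|exact: dh].
Qed.

Lemma disc_algebraZ (c : R[i]) g :
  disc_algebra g -> disc_algebra (fun z => c * g z).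
Proof.
move=> [cg dg]; split.
  by move=> x; apply: cvgM; [exact: cvg_cst|exact: cg].
by move=> w Dw; apply: derivableM; [exact: derivable_cst|exact: dg].
Qed.

Lemma taylor_bound0 (rho B : R) : 0 <= B -> taylor_bound rho B 0.
Proof.
move=> B0 w _; exists 0; first by rewrite Normc.normc0.
move=> z _; rewrite mul0r !subr0 Normc.normc0.
by rewrite mulr_ge0 ?exprn_ge0 ?normc_ge0.
Qed.

Lemma taylor_boundD (rho B C : R) g h :
  taylor_bound rho B g -> taylor_bound rho C h ->
  taylor_bound rho (B + C) (g + h).
Proof.
move=> tg th w wr; have [D DB gD] := tg w wr; have [E EC hE] := th w wr.
exists (D + E); first by rewrite (le_trans (normcD _ _)) ?lerD.
move=> z zr; rewrite mulrDl.
have -> : (g + h) z - (g + h) w - (D * (z - w) + E * (z - w)) =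
  (g z - g w - D * (z - w)) + (h z - h w - E * (z - w)).
  by rewrite -[(g + h) z]/(g z + h z) -[(g + h) w]/(g w + h w); ring.
by rewrite mulrDl (le_trans (normcD _ _)) ?lerD ?gD ?hE.
Qed.

Lemma taylor_boundZ (rho B : R) (c : R[i]) g :
  taylor_bound rho B g -> taylor_bound rho (normc c * B) (fun z => c * g z).
Proof.
move=> tg w wr; have [D DB gD] := tg w wr.
exists (c * D); first by rewrite Normc.normcM ler_wpM2l ?normc_ge0.
move=> z zr; have -> : c * g z - c * g w - c * D * (z - w) =
  c * (g z - g w - D * (z - w)) by ring.
by rewrite Normc.normcM -mulrA ler_wpM2l ?normc_ge0 ?gD.
Qed.

Lemma taylor_boundW (rho B C : R) g :
  B <= C -> taylor_bound rho B g -> taylor_bound rho C g.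
Proof.
move=> BC tg w wr; have [D DB gD] := tg w wr.
exists D; first exact: le_trans BC.
by move=> z zr; rewrite (le_trans (gD z zr)) // ler_wpM2r ?exprn_ge0 ?normc_ge0.
Qed.

Lemma taylor_bound_derivable (rho B : R) g w :
  normc w < rho -> taylor_bound rho B g -> derivable g w 1.
Proof.
move=> wr tg; have [D _ gD] := tg w (ltW wr).
apply: (@derivable_quadratic R g w D B (rho - normc w)); rewrite ?subr_gt0 //.
move=> z zw; apply: gD; rewrite -[z](subrK w) (le_trans (normcD _ _)) //.
by rewrite -lerBrDr ltW.
Qed.

(** As tau tends to 0 this tends to 1 at [a] and to 0 elsewhere on the closed
    disc, staying bounded by 1 there: the pole [(1 + tau) a] tends to [a] while
    the residue tends to 0. *)
Definition peak a (tau : R) z : R[i] :=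
  tau%:C%C / ((1 + tau)%:C%C - (a^*)%C * z).

Section OnePeak.
Variables (a : R[i]) (tau : R).
Hypotheses (a1 : normc a = 1) (tau0 : 0 < tau).

Let den z : R[i] := (1 + tau)%:C%C - (a^*)%C * z.

Let den_ge z : 1 + tau - normc z <= normc (den z).
Proof.
apply: le_trans (normc_lbD _ _); rewrite normc_opp Normc.normcM normc_conj a1.
by rewrite mul1r normc_real ger0_norm // addr_ge0 ?ler01 ?ltW.
Qed.

Let den_dist z : normc (z - a) - tau <= normc (den z).
Proof.
have -> : den z = - ((a^*)%C * (z - a)) + tau%:C%C.
  rewrite /den mulrBr [(a^*)%C * a]mulrC mul_conj_normc a1 expr1n.
  by rewrite !rmorphD /= rmorph1; ring.
apply: le_trans (normc_lbD _ _).
by rewrite normc_opp Normc.normcM normc_conj a1 mul1r normc_real gtr0_norm.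
Qed.

Let den_neq0 z : normc z <= 1 -> den z != 0.
Proof.
move=> z1; rewrite -normc_gt0 (lt_le_trans _ (den_ge z)) //.
by rewrite subr_gt0 (le_lt_trans z1) // ltrDl.
Qed.

Let denB z w : den z - den w = - ((a^*)%C * (z - w)).
Proof. by rewrite /den; ring. Qed.

Let normc_peak z : normc (peak a tau z) = tau / normc (den z).
Proof. by rewrite Normc.normcM Normc.normcV normc_real gtr0_norm. Qed.

Lemma peak_center : peak a tau a = 1.
Proof.
rewrite /peak [(a^*)%C * a]mulrC mul_conj_normc a1 expr1n rmorph1.
rewrite rmorphD rmorph1 addrAC subrr add0r divff //.
by rewrite -normc_gt0 normc_real normr_gt0 gt_eqF.
Qed.

Lemma peak_le1 z : normc z <= 1 -> normc (peak a tau z) <= 1.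
Proof.
move=> z1; rewrite normc_peak ler_pdivrMr ?normc_gt0 ?den_neq0 // mul1r.
by apply: le_trans (den_ge z); have := tau0; lra.
Qed.

Lemma peak_away (delta : R) z : normc z <= 1 ->
  tau <= delta / 2 -> delta <= normc (z - a) ->
  normc (peak a tau z) <= 2 * tau / delta.
Proof.
move=> z1 td dz; have d0 : 0 < delta by have := tau0; lra.
rewrite normc_peak ler_pdivrMr ?normc_gt0 ?den_neq0 //.
have -> : 2 * tau / delta * normc (den z) = tau * (2 * normc (den z) / delta).
  by ring.
rewrite ler_pMr // ler_pdivlMr // mul1r.
by have := den_dist z; lra.
Qed.

Lemma peak_taylor (rho : R) : 0 <= rho < 1 ->
  taylor_bound rho (tau / (1 - rho) ^+ 3) (peak a tau).
Proof.
move=> /andP[rho0 rho1].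
have den_r z : normc z <= rho -> 1 - rho <= normc (den z).
  by move=> zr; apply: le_trans (den_ge z); have := tau0; lra.
have r0 : 0 < 1 - rho by rewrite subr_gt0.
have n0 z : normc z <= rho -> 0 < normc (den z).
  by move=> /den_r; exact: lt_le_trans.
move=> w wr; exists (tau%:C%C * (a^*)%C / den w ^+ 2).
  rewrite !Normc.normcM Normc.normcV normc_conj a1 mulr1 normc_real gtr0_norm //.
  rewrite ler_pM2l // lef_pV2 ?posrE ?exprn_gt0 ?normc_gt0 ?expf_neq0 //;
    last by rewrite -normc_gt0 n0.
  rewrite expr2 Normc.normcM -expr2 exprS.
  rewrite -[leRHS]mul1r ler_pM ?exprn_ge0 ?(ltW r0) //; first lra.
  by rewrite lerXn2r ?nnegrE ?normc_ge0 ?(ltW r0) ?den_r.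
move=> z zr.
have dz : den z != 0 by rewrite -normc_gt0 n0.
have dw : den w != 0 by rewrite -normc_gt0 n0.
(* With p and q the denominators at z and w,
   1/p - 1/q + (p - q)/q^2 = (p - q)^2/(p q^2). *)
have -> : peak a tau z - peak a tau w
    - tau%:C%C * (a^*)%C / den w ^+ 2 * (z - w) =
    tau%:C%C * ((a^*)%C * (z - w)) ^+ 2 / (den z * den w ^+ 2).
  rewrite /peak -!/(den _).
  have -> : tau%:C%C * (a^*)%C / den w ^+ 2 * (z - w) =
    - (tau%:C%C / den w ^+ 2 * (den z - den w)) by rewrite denB; ring.
  rewrite -[(a^*)%C * (z - w)]opprK -denB.
  by field; rewrite dz dw.
rewrite !Normc.normcM Normc.normcV normc_real gtr0_norm //.
rewrite expr2 !Normc.normcM normc_conj a1 !mul1r -expr2 mulrAC ler_wpM2r //.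
  by rewrite exprn_ge0 ?normc_ge0.
rewrite ler_pM2l // lef_pV2 ?posrE ?exprn_gt0 //; last first.
  by rewrite !mulr_gt0 ?n0.
rewrite exprS [_ ^+ 2]expr2 !ler_pM ?mulr_ge0 ?(ltW r0) ?den_r //.
Qed.

Lemma peak_disc_algebra : disc_algebra (peak a tau).
Proof.
split; last first.
  move=> w; rewrite /unit_disc /= => w1.
  apply: (@taylor_bound_derivable ((1 + normc w) / 2)); last apply: peak_taylor.
    by lra.
  by have := normc_ge0 w; lra.
apply/within_planeP => w w1 e e0; exists (e * tau); first by rewrite mulr_gt0.
move=> z z1 zw.
have lbd y : normc y <= 1 -> tau <= normc (den y).
  by move=> y1; apply: le_trans (den_ge y); have := tau0; lra.
have -> : peak a tau z - peak a tau w =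
    tau%:C%C * ((a^*)%C * (z - w)) / (den z * den w).
  rewrite /peak -!/(den _) -[(a^*)%C * (z - w)]opprK -denB.
  by field; rewrite !den_neq0.
rewrite !Normc.normcM Normc.normcV !Normc.normcM normc_conj a1 mul1r.
rewrite normc_real gtr0_norm // ltr_pdivrMr ?mulr_gt0 ?normc_gt0 ?den_neq0 //.
apply: (@lt_le_trans _ _ (tau * (e * tau))); first by rewrite ltr_pM2l.
rewrite mulrCA ler_pM2l // ler_pM ?lbd // ?ltW //.
Qed.

End OnePeak.

Lemma finite_separation (s : seq R[i]) a : a \notin s ->
  exists2 delta : R, 0 < delta & forall x, x \in s -> delta <= normc (x - a).
Proof.
elim: s => [|x s IH]; first by exists 1.
rewrite inE negb_or => /andP[ax /IH[d d0 dP]].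
exists (Num.min d (normc (x - a))).
  by rewrite lt_min d0 normc_gt0 subr_eq0 eq_sym.
move=> y; rewrite inE => /predU1P[->|ys]; first by rewrite ge_min lexx orbT.
by rewrite ge_min dP.
Qed.

(** Peaks are added one at a time: where the new peak is not small, the
    previous sum is, because the new centre was among the points at which it
    was made small. This keeps the sup norm close to 1 whatever the number of
    peaks. *)
Lemma peak_interpolation (F B : seq R[i]) (eta rho : R) :
  0 < eta -> 0 <= rho < 1 ->
  {in F, forall a, normc a = 1} -> {in B, forall b, normc b = 1} ->
  uniq F -> {in F, forall a, a \notin B} ->
  exists g, [/\ disc_algebra g, taylor_bound rho eta g,
    forall z, normc z <= 1 -> normc (g z) <= 1 + eta,
    {in F, forall a, normc (g a - 1) <= eta} &
    {in B, forall b, normc (g b) <= eta}].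
Proof.
move=> + rho01; elim: F B eta => [|a F IH] B eta eta0.
  move=> _ _ _ _; exists 0; split => //.
  - exact: disc_algebra0.
  - exact/taylor_bound0/ltW.
  - by move=> z _; rewrite -[X in normc X]/(0 : R[i]) Normc.normc0; lra.
  - by move=> b _; rewrite -[X in normc X]/(0 : R[i]) Normc.normc0; lra.
move=> F1 B1 /= /andP[aF uF] FB.
have a1 : normc a = 1 by apply: F1; rewrite mem_head.
have aB : a \notin B by apply: FB; rewrite mem_head.
have [|||||g [gA gT g1 gF gB]] := IH (a :: B) (eta / 3).
- by lra.
- by move=> x xF; apply: F1; rewrite inE xF orbT.
- by move=> x; rewrite inE => /predU1P[->//|]; exact: B1.
- exact: uF.
- move=> x xF; rewrite inE negb_or FB ?inE ?xF ?orbT // andbT.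
  by apply: contraNneq aF => <-.
have /within_planeP gC := gA.1.
have Da : closed_unit_disc a by rewrite /closed_unit_disc /= a1.
have eta3 : 0 < eta / 3 by lra.
have [d1 d10 gd1] := gC a Da _ eta3.
have [|d2 d20 sep] := @finite_separation (F ++ B) a.
  by rewrite mem_cat negb_or aF.
have [d [d0 dd1 dd2]] : exists d : R, [/\ 0 < d, d <= d1 & d <= d2].
  by exists (Num.min d1 d2); rewrite lt_min d10 !ge_min !lexx orbT.
have /andP[rho0 rho1] := rho01.
have r30 : 0 < (1 - rho) ^+ 3 by rewrite exprn_gt0 // subr_gt0.
have [tau [tau0 tau1 tau2 tau3]] : exists tau : R, [/\ 0 < tau, tau <= d / 2,
    tau <= eta / 3 / 2 * d & tau <= eta / 3 * (1 - rho) ^+ 3].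
  exists (Num.min (d / 2)
    (Num.min (eta / 3 / 2 * d) (eta / 3 * (1 - rho) ^+ 3))).
  split; rewrite ?ge_min ?lexx ?orbT // !lt_min.
  rewrite (divr_gt0 d0) ?ltr0n // (mulr_gt0 eta3 r30) andbT.
  by rewrite (mulr_gt0 (divr_gt0 eta3 _) d0) ?ltr0n.
have {}tau2 : 2 * tau / d <= eta / 3 by rewrite ler_pdivrMr //; lra.
rewrite -ler_pdivrMr // in tau3.
have pT : taylor_bound rho (eta / 3) (peak a tau).
  by apply: taylor_boundW tau3 _; exact: peak_taylor.
clear tau3 r30.
have far z : normc z <= 1 -> d <= normc (z - a) ->
    normc (peak a tau z) <= eta / 3.
  by move=> z1 dz; apply: le_trans tau2; exact: peak_away.
have sepd x : x \in F ++ B -> d <= normc (x - a).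
  by move=> /sep; exact: le_trans.
exists (g + peak a tau); split.
- exact: disc_algebraD gA (peak_disc_algebra a1 tau0).
- have : taylor_bound rho (eta / 3 + eta / 3) (g + peak a tau).
    exact: taylor_boundD gT pT.
  by apply: taylor_boundW; lra.
- move=> z z1; apply: (le_trans (normcD _ _)).
  have [dz|zd] := leP d (normc (z - a)).
    by have := far z z1 dz; have := g1 z z1; lra.
  have := peak_le1 a1 tau0 z1.
  have : normc (g z - g a) < eta / 3.
    by apply: gd1 => //; exact: lt_le_trans zd dd1.
  have := gB a (mem_head _ _).
  have := normcD (g z - g a) (g a); rewrite subrK; lra.
- move=> x; rewrite inE => /predU1P[->|xF].
    rewrite -[(g + _) a]/(g a + peak a tau a) peak_center // addrK.
    by have := gB a (mem_head _ _); lra.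
  rewrite -[(g + _) x]/(g x + peak a tau x) addrAC.
  apply: (le_trans (normcD _ _)); have := gF x xF.
  have := far x _ (sepd x _); rewrite mem_cat xF F1 ?inE ?xF ?orbT //.
  by move=> /(_ (lexx _) isT); lra.
- move=> x xB; apply: (le_trans (normcD _ _)).
  have := gB x; rewrite inE xB orbT => /(_ isT).
  have := far x _ (sepd x _); rewrite mem_cat xB orbT B1 //.
  by move=> /(_ (lexx _) isT); lra.
Qed.

End Peaks.

(** * Perturbations oscillating on a perfect subset of the circle *)

Section Circle.
Variable R : realType.

Lemma compact_plane (A : set R[i]) (M : R) :
  closed A -> (forall z, A z -> normc z <= M) -> compact A.
Proof.
move=> clA AM; pose f (p : R * R) : R[i] := (p.1 +i* p.2)%C.
have cf : continuous f.
  move=> p B /nbhs_planeP[e e0 eB].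
  have e2 : 0 < e / 2 by rewrite divr_gt0.
  exists (ball p.1 (e / 2), ball p.2 (e / 2)).
    by split; exact: nbhsx_ballx.
  case: p e2 eB => a b e2 eB [c d] [/=]; rewrite /ball /= => ac bd; apply: eB.
  apply: (le_lt_trans (normc_le_ReIm _)); rewrite ReB ImB /=.
  by rewrite distrC in ac; rewrite distrC in bd; lra.
have cI : compact `[(- M), M]%classic by exact: segment_compact.
have cB := continuous_compact (continuous_subspaceT cf) (compact_setX cI cI).
apply: (subclosed_compact clA cB) => z /AM zM.
exists (complex.Re z, complex.Im z).
  split => /=; rewrite in_itv /= -ler_norml; apply: le_trans zM.
    exact: normc_Re.
  exact: normc_Im.
by case: z zM.
Qed.

Lemma expiD (s t : R) : expi (s + t) = expi s * expi t :> R[i].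
Proof. by rewrite /expi cosD sinD; simpc; rewrite [sin s * _ + _]addrC. Qed.

Lemma normc_expi (s : R) : normc (expi s) = 1.
Proof. by rewrite /= cos2Dsin2 sqrtr1. Qed.

(** The angle is the arcsine of the imaginary part: the real part is positive
    near 1, and [asin] is continuous at 0. *)
Lemma expi_surj_near1 (delta : R) : 0 < delta -> exists2 r : R, 0 < r &
  forall c : R[i], normc c = 1 -> normc (c - 1) < r ->
    exists2 s : R, `|s| < delta & expi s = c.
Proof.
move=> d0; have : {for (0:R), continuous (@asin R)}.
  by apply: continuous_asin; lra.
move=> /(_ (ball (asin 0) delta)) /=.
move=> /(_ (nbhsx_ballx _ _ d0)) /nbhs_ballP[r /= r0 rP].
exists (Num.min r 1); first by rewrite lt_min r0 /=.
move=> c; have := normc_Im (c - 1); have := normc_Re (c - 1).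
rewrite ReB ImB; case: c => a b; rewrite [complex.Re _]/= [complex.Im _]/=.
rewrite -[complex.Re 1]/(1 : R) -[complex.Im 1]/(0 : R) subr0.
move=> ha hb ab1; rewrite lt_min => /andP[cr c1].
have ab : a ^+ 2 + b ^+ 2 = 1.
  by rewrite -(sqr_sqrtr (_ : 0 <= a ^+ 2 + b ^+ 2)) ?addr_ge0 ?sqr_ge0 //;
    rewrite -/(normc (a +i* b)%C) ab1 expr1n.
have a0 : 0 < a by move: (le_lt_trans ha c1); rewrite ltr_norml; lra.
have b1 : - 1 <= b <= 1.
  by rewrite -ler_norml (le_trans hb) // ltW.
exists (asin b); last first.
  rewrite /expi asinK // cos_asin //; congr (_ +i* _)%C.
  have -> : 1 - b ^+ 2 = a ^+ 2 by rewrite -ab addrK.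
  by rewrite sqrtr_sqr gtr0_norm.
have as0 : asin 0 = 0 :> R.
  rewrite -{1}(@sin0 R) sinK // in_itv /=.
  by have := @pi_gt0 R; lra.
have := rP b; rewrite /ball /= as0 !sub0r !normrN; apply.
exact: le_lt_trans hb cr.
Qed.

Lemma expi_surj_near (delta : R) : 0 < delta -> exists2 r : R, 0 < r &
  forall (theta : R) (a : R[i]), normc a = 1 -> normc (a - expi theta) < r ->
    exists2 y : R, `|y - theta| < delta & expi y = a.
Proof.
move=> /expi_surj_near1[r r0 rP]; exists r => // theta a a1 ar.
have e1 : normc (expi theta : R[i]) = 1 := normc_expi theta.
have ee : expi theta * ((expi theta)^*)%C = 1 :> R[i].
  by rewrite mul_conj_normc e1 expr1n rmorph1.
have [||s sd sE] := rP (((expi theta)^*)%C * a).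
- by rewrite Normc.normcM normc_conj e1 a1 mulr1.
- have -> : ((expi theta)^*)%C * a - 1 = ((expi theta)^*)%C * (a - expi theta).
    by rewrite mulrBr [_ * expi theta]mulrC ee.
  by rewrite Normc.normcM normc_conj e1 mul1r.
exists (theta + s); first by rewrite addrAC subrr add0r.
by rewrite expiD sE mulrA ee mul1r.
Qed.

Lemma nonisolated_near (K : set R[i]) (s : seq R[i]) a (r : R) :
  isolated K = set0 -> K a -> 0 < r ->
  exists b, [/\ K b, b \notin s, b != a & normc (b - a) < r].
Proof.
move=> K0 Ka r0.
have [|d d0 dP] := @finite_separation R [seq x <- s | x != a] a.
  by rewrite mem_filter eqxx.
apply: contrapT => noB; suff : isolated K a by rewrite K0.
split; first exact/mem_set.
exists [set y | normc (y - a) < Num.min r d].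
  by apply/nbhs_planeP; exists (Num.min r d); rewrite ?lt_min ?r0.
apply/seteqP; split => [y [/= yd Ky]|_ ->]; last first.
  by split; rewrite //= subrr Normc.normc0 lt_min r0.
apply: contrapT => /eqP ya; apply: noB; exists y.
move: yd; rewrite lt_min => /andP[yr yd]; split => //.
apply/negP => ys; have := dP y; rewrite mem_filter ya ys => /(_ isT).
by rewrite leNgt yd.
Qed.

(** Near each [a] of a finite net of [K] there is another point [b] of [K],
    because [K] is perfect; a sum of peaks centred at the [a] and small at the
    [b] creates a jump of about [eps / 2] between [a] and [b], while [u] varies
    by less than [eps / 32] from one to the other. Whatever [theta] is in [K],
    one of the [a] and [b] near it then violates the [k]-Lipschitz bound at
    [theta]. Only the values of [v] at three points enter, so that the
    conclusion survives a further perturbation of size [eps / 32]. *)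
Lemma oscillating_perturbation (K : set R[i]) (u : R[i] -> R) (k : nat)
    (eps rho : R) :
  compact K -> K `<=` unit_circle (R:=R) -> isolated K = set0 ->
  {within K, continuous u} -> (0 < k)%N -> 0 < eps -> 0 <= rho < 1 ->
  exists g : R[i] -> R[i], [/\ disc_algebra g, taylor_bound rho eps g,
    forall z, normc z <= 1 -> normc (g z) <= eps &
    forall v : R[i] -> R,
      (forall z, K z -> `|v z - (u z + complex.Re (g z))| <= eps / 32) ->
      forall theta : R, K (expi theta) -> exists y : R,
        [/\ theta - k%:R^-1 < y < theta + k%:R^-1, K (expi y)
          & k%:R * `|y - theta| < `|v (expi y) - v (expi theta)|]].
Proof.
move=> cK K1 K0 /within_plane_realP cu k0 e0 rho01.
have kR : 0 < k%:R :> R by rewrite ltr0n.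
have [d [d0 dk de]] : exists d : R,
    [/\ 0 < d, d <= k%:R^-1 & k%:R * d <= eps / 8].
  exists (Num.min k%:R^-1 (eps / 8 / k%:R)).
  have h : 0 < eps / 8 / k%:R by rewrite !divr_gt0.
  rewrite lt_min invr_gt0 kR h; split => //; first by rewrite ge_min lexx.
  by rewrite mulrC -ler_pdivlMr // ge_min lexx orbT.
have [r1 r10 r1P] := expi_surj_near d0.
have /choice[r rP] : forall x, exists rx : R, K x -> [/\ 0 < rx, rx <= r1 / 2 &
    forall y, K y -> normc (y - x) < rx -> `|u y - u x| < eps / 32].
  move=> x; have [Kx|] := pselect (K x); last by exists 0.
  have e32 : 0 < eps / 32 by rewrite divr_gt0.
  have [rx rx0 rxP] := cu x Kx _ e32.
  exists (Num.min rx (r1 / 2)) => _; split.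
  - by rewrite lt_min rx0 divr_gt0.
  - by rewrite ge_min lexx orbT.
  - by move=> y Ky; rewrite lt_min => /andP[yr _]; exact: rxP.
have cov := cK; rewrite compact_cover in cov.
have [|x Kx|D DK DC] := cov R[i] K (fun x => [set y | normc (y - x) < r x]).
- move=> x Kx; rewrite openE => y /= yx.
  apply/nbhs_planeP; exists (r x - normc (y - x)); first by rewrite subr_gt0.
  move=> z zy; apply: (le_lt_trans (normc_distD y _ _)).
  by move: zy; rewrite ltrBrDr.
- exists x => //=; rewrite subrr Normc.normc0.
  by have [] := rP x Kx.
pose F := finmap.enum_fset D.
have FK a : a \in F -> K a by move=> aD; have := DK a aD; rewrite inE.
have /choice[b bP] : forall a, exists b, K a ->
    [/\ K b, b \notin F, b != a & normc (b - a) < r a].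
  move=> a; have [Ka|] := pselect (K a); last by exists 0.
  have [r0 _ _] := rP a Ka.
  by have [b bP] := nonisolated_near F K0 Ka r0; exists b.
have [|a aF|b' /mapP[a aF ->]||a aF|h [hA hT h1 hF hB]] :=
    @peak_interpolation R F [seq b a | a <- F] (1 / 16) rho _ rho01.
- by lra.
- exact/K1/FK.
- by have [Kb _ _ _] := bP a (FK a aF); exact: K1.
- exact: finmap.fset_uniq.
- apply/negP => /mapP[c cF ac].
  by have [_ /negP + _ _] := bP c (FK c cF); rewrite -ac.
pose c : R[i] := (eps / 2)%:C%C.
have nc : normc c = eps / 2 by rewrite normc_real ger0_norm ?divr_ge0 ?ltW.
exists (fun z => c * h z); split.
- exact: disc_algebraZ.
- have : taylor_bound rho (normc c * (1 / 16)) (fun z => c * h z).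
    exact: taylor_boundZ.
  by apply: taylor_boundW; rewrite nc; lra.
- move=> z /h1 z1; rewrite Normc.normcM nc.
  have : eps / 2 * normc (h z) <= eps / 2 * (1 + 1 / 16).
    by rewrite ler_pM2l // divr_gt0.
  by move=> ?; lra.
move=> v vP theta Kt.
have [a aF /= ta] := DC _ Kt.
have Ka : K a := FK a aF.
have [r0 rr1 ru] := rP a Ka.
have [Kb _ _ ba] := bP a Ka.
set p := b a in Kb ba.
have Rec z : complex.Re (c * h z) = eps / 2 * complex.Re (h z).
  by case: (h z) => x y; rewrite /= mul0r subr0.
have jump : eps / 4 < v a - v p.
  have := vP a Ka; have := vP p Kb; rewrite !Rec !ler_norml.
  have := ru p Kb ba; rewrite ltr_norml.
  have : - (1 / 16) <= complex.Re (h a) - 1.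
    have : `|complex.Re (h a - 1)| <= 1 / 16.
      by apply: le_trans (normc_Re _) _; exact: hF.
    by rewrite ReB ler_norml => /andP[].
  have : complex.Re (h p) <= 1 / 16.
    have : `|complex.Re (h p)| <= 1 / 16.
      by apply: le_trans (normc_Re _) _; apply: hB; exact: map_f.
    by rewrite ler_norml => /andP[].
  move=> hp ha.
  have : eps / 2 * complex.Re (h p) <= eps / 2 * (1 / 16).
    by rewrite ler_pM2l // divr_gt0.
  have : eps / 2 * (15 / 16) <= eps / 2 * complex.Re (h a).
    by rewrite ler_pM2l ?divr_gt0 //; lra.
  by lra.
have near q : K q -> normc (q - expi theta) < r1 ->
    eps / 8 < `|v q - v (expi theta)| -> exists y : R,
    [/\ theta - k%:R^-1 < y < theta + k%:R^-1, K (expi y)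
      & k%:R * `|y - theta| < `|v (expi y) - v (expi theta)|].
  move=> Kq qr1 qv; have [y yd yE] := r1P theta q (K1 q Kq) qr1.
  exists y; rewrite yE; split => //.
    by move: (lt_le_trans yd dk); rewrite ltr_distl.
  apply: le_lt_trans qv; apply: le_trans de.
  by rewrite ler_pM2l // ltW.
have at_ : normc (a - expi theta) < r a by rewrite normc_distC.
have [av|av] := ltP (eps / 8) `|v a - v (expi theta)|.
  by apply: (near a) => //; lra.
apply: (near p) => //.
  by apply: (le_lt_trans (normc_distD a _ _)); lra.
move: av; rewrite ltr_normr ler_norml; move=> /andP[_ av].
by apply/orP; right; lra.
Qed.

End Circle.

(** * Geometrically convergent sequences of disc algebra functions *)

Section Limits.
Variable R : realType.

Lemma geometric_small (C q e : R) : 0 <= C -> 0 <= q <= 1 / 2 -> 0 < e ->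
  exists t : nat, C * q ^+ t < e.
Proof.
move=> C0 /andP[q0 q2] e0.
have q1 : `|q| < 1 by rewrite ger0_norm //; lra.
have /cvgrPdist_lt/(_ e e0)[t _ tP] := cvg_geometric C q1.
exists t; have := tP t (leqnn t); rewrite /= sub0r normrN ger0_norm //.
by rewrite mulr_ge0 ?exprn_ge0.
Qed.

Lemma le_geometric (a b C q : R) : 0 <= C -> 0 <= q <= 1 / 2 ->
  (forall t : nat, a <= b + C * q ^+ t) -> a <= b.
Proof.
move=> C0 q01 ab; apply/ler_addgt0Pr => e e0.
have [t te] := geometric_small C0 q01 e0.
by apply: (le_trans (ab t)); rewrite lerD2l ltW.
Qed.

(** The intervals of centre [x t] and radius [2 C q^t] are nested. *)
Lemma geometric_cvg_real (x : nat -> R) (C q : R) : 0 <= C -> 0 <= q <= 1 / 2 ->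
  (forall t, `|x t.+1 - x t| <= C * q ^+ t) ->
  exists l, forall t, `|l - x t| <= 2 * C * q ^+ t.
Proof.
move=> C0 /andP[q0 q2] xP.
pose r t := 2 * C * q ^+ t.
have r0 t : 0 <= r t by rewrite /r !mulr_ge0 ?exprn_ge0.
have rS t : C * q ^+ t + r t.+1 <= r t.
  have y0 : 0 <= C * q ^+ t by rewrite mulr_ge0 ?exprn_ge0.
  have -> : r t.+1 = 2 * q * (C * q ^+ t) by rewrite /r exprS; ring.
  have -> : r t = 2 * (C * q ^+ t) by rewrite /r; ring.
  by have := ler_wpM2r y0 q2; lra.
have lo s t : x s - r s <= x (s + t)%N - r (s + t)%N.
  elim: t => [|t IH]; rewrite ?addn0 ?addnS //; apply: (le_trans IH).
  by have := xP (s + t)%N; have := rS (s + t)%N; rewrite ler_norml; lra.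
have hi s t : x (s + t)%N + r (s + t)%N <= x s + r s.
  elim: t => [|t IH]; rewrite ?addn0 ?addnS //; apply: le_trans IH.
  by have := xP (s + t)%N; have := rS (s + t)%N; rewrite ler_norml; lra.
have nested s t : x s - r s <= x t + r t.
  have := lo s t; have := hi t s; rewrite addnC.
  by have := r0 (s + t)%N; lra.
pose E := [set x t - r t | t in [set: nat]].
exists (sup E) => t; rewrite ler_distl; apply/andP; split.
  apply: ub_le_sup; last by exists t.
  by exists (x 0%N + r 0%N) => _ [s _ <-].
by apply: ge_sup => [|_ [s _ <-]]; first by exists (x t - r t), t.
Qed.

Lemma geometric_cvg (z : nat -> R[i]) (C q : R) : 0 <= C -> 0 <= q <= 1 / 2 ->
  (forall t, normc (z t.+1 - z t) <= C * q ^+ t) ->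
  exists l, forall t, normc (l - z t) <= 4 * C * q ^+ t.
Proof.
move=> C0 q01 zP.
have [t|a aP] := @geometric_cvg_real (fun t => complex.Re (z t)) C q C0 q01.
  by rewrite -ReB; apply: le_trans (normc_Re _) (zP t).
have [t|b bP] := @geometric_cvg_real (fun t => complex.Im (z t)) C q C0 q01.
  by rewrite -ImB; apply: le_trans (normc_Im _) (zP t).
exists (a +i* b)%C => t; apply: (le_trans (normc_le_ReIm _)).
rewrite ReB ImB /=; have := aP t; have := bP t; lra.
Qed.

(** Taylor estimates at a fixed point pass to the limit: the derivatives form a
    geometrically convergent sequence. *)
Lemma taylor_bound_limit (g : nat -> R[i] -> R[i]) (G : R[i] -> R[i])
    (rho C M q : R) :
  0 <= C -> 0 <= M -> 0 <= q <= 1 / 2 ->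
  (forall t, taylor_bound rho (C * q ^+ t) (g t.+1 - g t)) ->
  (forall t z, normc z <= rho -> normc (G z - g t z) <= M * q ^+ t) ->
  taylor_bound rho (4 * C) (G - g 0%N).
Proof.
move=> C0 M0 q01 gT Gg w wr; have /andP[q0 q2] := q01.
have /choice[D DP] : forall t, exists D : R[i], normc D <= C * q ^+ t /\
    forall z, normc z <= rho ->
      normc ((g t.+1 - g t) z - (g t.+1 - g t) w - D * (z - w))
        <= C * q ^+ t * normc (z - w) ^+ 2.
  by move=> t; have [D DC DP] := gT t w wr; exists D.
pose S t := \sum_(s < t) D s.
have SS t : S t.+1 = S t + D t by rewrite /S big_ord_recr.
have [t|E EP] := @geometric_cvg S C q C0 q01.
  by rewrite SS [S t + _]addrC addrK; have [] := DP t.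
have S0 : S 0%N = 0 by rewrite /S big_ord0.
exists E; first by have := EP 0%N; rewrite S0 subr0 expr0 mulr1.
move=> z zr; set d := normc (z - w).
have d0 : 0 <= d := normc_ge0 _.
have part t : normc (g t z - g 0%N z - (g t w - g 0%N w) - S t * (z - w))
    <= 2 * C * (1 - q ^+ t) * d ^+ 2.
  elim: t => [|t IH].
    by rewrite S0 !subrr mul0r subr0 Normc.normc0 mulr0 mul0r.
  have [_ /(_ z zr)] := DP t; rewrite -/d => Dt.
  have -> : g t.+1 z - g 0%N z - (g t.+1 w - g 0%N w) - S t.+1 * (z - w) =
      (g t z - g 0%N z - (g t w - g 0%N w) - S t * (z - w)) +
      ((g t.+1 - g t) z - (g t.+1 - g t) w - D t * (z - w)).
    rewrite SS -[(g t.+1 - g t) z]/(g t.+1 z - g t z).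
    by rewrite -[(g t.+1 - g t) w]/(g t.+1 w - g t w); ring.
  apply: (le_trans (normcD _ _)).
  apply: (le_trans (lerD IH Dt)).
  rewrite -mulrDl ler_wpM2r ?exprn_ge0 //.
  have -> : 2 * C * (1 - q ^+ t) + C * q ^+ t = C * (2 - q ^+ t) by ring.
  have -> : 2 * C * (1 - q ^+ t.+1) = C * (2 - 2 * q * q ^+ t).
    by rewrite exprS; ring.
  rewrite ler_wpM2l // lerD2l lerN2 ler_piMl ?exprn_ge0 //; lra.
apply: (@le_geometric _ _ (2 * M + 4 * C * d) q) => //.
  by rewrite addr_ge0 ?mulr_ge0.
move=> t; set X := _ - _ in part *.
have -> : (G - g 0%N) z - (G - g 0%N) w - E * (z - w) =
    (g t z - g 0%N z - (g t w - g 0%N w) - S t * (z - w)) +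
    (G z - g t z) + - (G w - g t w) + - ((E - S t) * (z - w)).
  rewrite -[(G - g 0%N) z]/(G z - g 0%N z) -[(G - g 0%N) w]/(G w - g 0%N w).
  by ring.
apply: (le_trans (normcD _ _)); rewrite normc_opp Normc.normcM -/d.
have h1 : normc (E - S t) * d <= 4 * C * q ^+ t * d by rewrite ler_wpM2r.
have h2 := Gg t w wr; have h3 := Gg t z zr; have h4 := part t.
have h5 : 2 * C * (1 - q ^+ t) * d ^+ 2 <= 4 * C * d ^+ 2.
  rewrite ler_wpM2r ?exprn_ge0 // -mulrA [4 * C]mulrC [2 * _]mulrC -mulrA.
  by rewrite ler_wpM2l //; have := exprn_ge0 t q0; lra.
have h6 := normcD (g t z - g 0%N z - (g t w - g 0%N w) - S t * (z - w) +
    (G z - g t z)) (- (G w - g t w)).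
have h7 := normcD (g t z - g 0%N z - (g t w - g 0%N w) - S t * (z - w))
    (G z - g t z).
rewrite normc_opp in h6.
rewrite [(2 * M + _) * _]mulrDl.
have -> : 4 * C * d * q ^+ t = 4 * C * q ^+ t * d by ring.
move: h1 h2 h3 h4 h5 h6 h7.
lra.
Qed.

Definition radius (t : nat) : R := 1 - t.+2%:R^-1.

Lemma radius_itv t : 0 <= radius t < 1.
Proof.
have t0 : 0 < t.+2%:R :> R by rewrite ltr0n.
rewrite /radius subr_ge0 invf_le1 // ler1n /= ltrBlDr ltrDl invr_gt0.
exact: t0.
Qed.

Lemma radius_le s t : (s <= t)%N -> radius s <= radius t.
Proof.
by move=> st; rewrite lerD2l lerN2 lef_pV2 ?posrE ?ltr0n // ler_nat.
Qed.

Lemma radius_cofinal (x : R) : x < 1 -> exists t, x < radius t.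
Proof.
move=> x1; have x0 : 0 < 1 - x by rewrite subr_gt0.
have [t xt] : exists t : nat, (1 - x)^-1 < t%:R.
  exists (Num.bound (1 - x)^-1); apply: archimedean.Num.Theory.archi_boundP.
  by rewrite invr_ge0 ltW.
exists t; rewrite /radius ltrBrDr -ltrBrDl invf_plt ?posrE ?ltr0n //.
by apply: (lt_trans xt); rewrite ltr_nat.
Qed.

(** On a smaller disc the limit is the sum of an early term of the sequence and
    of a tail that has a Taylor estimate. *)
Lemma disc_algebra_limit (g : nat -> R[i] -> R[i]) (C q : R) :
  0 <= C -> 0 <= q <= 1 / 2 -> (forall t, disc_algebra (g t)) ->
  (forall t z, normc z <= 1 -> normc (g t.+1 z - g t z) <= C * q ^+ t) ->
  (forall t, taylor_bound (radius t) (C * q ^+ t) (g t.+1 - g t)) ->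
  exists2 G, disc_algebra G &
    forall t z, normc z <= 1 -> normc (G z - g t z) <= 4 * C * q ^+ t.
Proof.
move=> C0 q01 gA gC gT; have /andP[q0 q2] := q01.
have /choice[G GP] : forall z : R[i], exists l : R[i], normc z <= 1 ->
    forall t, normc (l - g t z) <= 4 * C * q ^+ t.
  move=> z; have [z1|] := pselect (normc z <= 1 :> R); last by exists 0.
  have [t|l lP] := @geometric_cvg (fun t => g t z) C q C0 q01; first exact: gC.
  by exists l.
exists G; last by move=> t z /GP.
have C40 : 0 <= 4 * C by rewrite mulr_ge0.
split.
  apply/within_planeP => x x1 e e0; have e3 : 0 < e / 3 by rewrite divr_gt0.
  have [t te] := geometric_small C40 q01 e3.
  have /within_planeP gc := (gA t).1; have [d d0 dP] := gc x x1 _ e3.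
  exists d => // y y1 yx; have := dP y y1 yx.
  have := GP x x1 t; have := GP y y1 t.
  have := normc_distD (g t y) (G y) (G x).
  have := normc_distD (g t x) (g t y) (G x).
  by rewrite [normc (g t x - G x)]normc_distC; lra.
move=> w w1; have [T wT] := radius_cofinal w1.
have /andP[_ rT1] := radius_itv T.
have tH : taylor_bound (radius T) (4 * (C * q ^+ T)) (G - g T).
  have rT t : radius T <= radius (t + T)%N := radius_le (leq_addl t T).
  apply: (@taylor_bound_limit (fun t => g (t + T)%N) G _ _ (4 * C * q ^+ T) q);
    rewrite ?mulr_ge0 ?exprn_ge0 //.
    move=> t x xr; have -> : C * q ^+ T * q ^+ t = C * q ^+ (t + T).
      by rewrite exprD; ring.
    have [D DC DP] := gT (t + T)%N x (le_trans xr (rT t)).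
    by exists D => // z zr; apply: DP; apply: le_trans zr (rT t).
  move=> t z zr; have -> : 4 * C * q ^+ T * q ^+ t = 4 * C * q ^+ (t + T).
    by rewrite exprD; ring.
  exact: GP (le_trans zr (ltW rT1)) _.
rewrite -[G](subrK (g T)); apply: derivableD; last exact: (gA T).2.
exact: taylor_bound_derivable wT tH.
Qed.

End Limits.

(** * Perturbation along all components *)

Section WithinContinuity.
Variable R : realType.

Lemma within_comp (A B : set R[i]) (f g : R[i] -> R[i]) :
  (forall z, A z -> B (f z)) -> {within A, continuous f} ->
  {within B, continuous g} -> {within A, continuous (g \o f)}.
Proof.
move=> AB /within_planeP cf /within_planeP cg; apply/within_planeP.
move=> x Ax e e0; have [d d0 dP] := cg (f x) (AB x Ax) e e0.
have [r r0 rP] := cf x Ax d d0; exists r => // y Ay yx.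
by apply: dP; [exact: AB|exact: rP].
Qed.

Lemma within_Re (A : set R[i]) (f : R[i] -> R[i]) :
  {within A, continuous f} ->
  {within A, continuous (fun z => complex.Re (f z))}.
Proof.
move=> /within_planeP cf; apply/within_plane_realP => x Ax e e0.
have [d d0 dP] := cf x Ax e e0; exists d => // y Ay yx.
by rewrite -ReB; apply: le_lt_trans (normc_Re _) (dP y Ay yx).
Qed.

Lemma within_add_sum (A : set R[i]) (I : Type) (r : seq I) (f : R[i] -> R[i])
    (F : I -> R[i] -> R[i]) :
  {within A, continuous f} -> (forall i, {within A, continuous (F i)}) ->
  {within A, continuous (fun z => f z + \sum_(i <- r) F i z)}.
Proof.
move=> cf cF; elim: r f cf => [|i r IH] f cf.
  have -> : (fun z => f z + \sum_(i <- [::]) F i z) = f.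
    by apply/funext => z; rewrite big_nil addr0.
  exact: cf.
have -> : (fun z => f z + \sum_(j <- i :: r) F j z) =
    (fun z => (f z + F i z) + \sum_(j <- r) F j z).
  by apply/funext => z; rewrite big_cons addrA.
by apply: IH => x; apply: cvgD; [exact: cf|exact: cF].
Qed.

Lemma derivable_add_sum (I : Type) (r : seq I) (f : R[i] -> R[i])
    (F : I -> R[i] -> R[i]) (x : R[i]) :
  derivable f x 1 -> (forall i, derivable (F i) x 1) ->
  derivable (fun z => f z + \sum_(i <- r) F i z) x 1.
Proof.
move=> cf cF; elim: r f cf => [|i r IH] f cf.
  have -> : (fun z => f z + \sum_(i <- [::]) F i z) = f.
    by apply/funext => z; rewrite big_nil addr0.
  exact: cf.
have -> : (fun z => f z + \sum_(j <- i :: r) F j z) =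
    (fun z => (f z + F i z) + \sum_(j <- r) F j z).
  by apply/funext => z; rewrite big_cons addrA.
by apply: IH; apply: derivableD; [exact: cf|exact: cF].
Qed.

Lemma derivable_eq_open (W : set R[i]) (f g : R[i] -> R[i]) (x : R[i]) :
  open W -> W x -> (forall z, W z -> f z = g z) ->
  derivable f x 1 -> derivable g x 1.
Proof.
move=> oW Wx fg /derivable_linP[D fD]; apply/derivable_linP; exists D => e e0.
have /nbhs_planeP[r r0 rW] := open_nbhs_nbhs (conj oW Wx).
have [d d0 dP] := fD e e0.
exists (Num.min r d); first by rewrite lt_min r0.
move=> y; rewrite lt_min => /andP[yr yd].
by rewrite -(fg x Wx) -(fg y (rW y yr)); exact: dP.
Qed.

Lemma normc_sum (I : Type) (r : seq I) (F : I -> R[i]) (M : R) :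
  (forall i, normc (F i) <= M) ->
  normc (\sum_(i <- r) F i) <= (size r)%:R * M.
Proof.
move=> FM; elim: r => [|i r IH]; first by rewrite big_nil Normc.normc0 mul0r.
rewrite big_cons; apply: (le_trans (normcD _ _)).
by rewrite /= -addn1 natrD addrC mulrDl mul1r lerD.
Qed.

End WithinContinuity.

Section Construction.
Variables (R : realType) (N : nat) (W J : set R[i]).
Variables (psi Phi : 'I_N.+1 -> R[i] -> R[i]).
Variables (L : 'I_N.+1 -> set R[i]) (K : 'I_N.+1 -> nat -> set R[i]).
Local Notation X := (W `|` J).

Hypothesis W_open : open W.
Hypothesis psi_cont : forall i, {within X, continuous (psi i)}.
Hypothesis psi_disc : forall i z, X z -> closed_unit_disc (psi i z).
Hypothesis psi_holo :
  forall i z, W z -> unit_disc (psi i z) /\ derivable (psi i) z 1.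
Hypothesis Phi_cont : forall i, {within L i, continuous (Phi i)}.
Hypothesis Phi_in : forall i w, L i w -> X (Phi i w).
Hypothesis PhiK : forall i w, L i w -> psi i (Phi i w) = w.
Hypothesis K_L : forall i m, (0 < m)%N -> K i m `<=` L i.
Hypothesis K_circle : forall i m, (0 < m)%N -> K i m `<=` @unit_circle R.
Hypothesis K_compact : forall i m, (0 < m)%N -> compact (K i m).
Hypothesis K_perfect : forall i m, (0 < m)%N -> isolated (K i m) = set0.

Definition perturb (f : R[i] -> R[i]) (G : 'I_N.+1 -> R[i] -> R[i]) z : R[i] :=
  f z + \sum_i G i (psi i z).

Lemma perturb_within f G : {within X, continuous f} ->
  (forall i, disc_algebra (G i)) -> {within X, continuous (perturb f G)}.
Proof.
move=> cf GA; rewrite /perturb.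
apply: (@within_add_sum R X _ _ f (fun i z => G i (psi i z)) cf) => i.
exact: (within_comp (@psi_disc i) (@psi_cont i) (GA i).1).
Qed.

Lemma perturb_derivable f G z : W z -> derivable f z 1 ->
  (forall i, disc_algebra (G i)) -> derivable (perturb f G) z 1.
Proof.
move=> Wz df GA; rewrite /perturb.
apply: (@derivable_add_sum R _ _ f (fun i z => G i (psi i z)) z df) => i.
have [Dz dz] := psi_holo i Wz.
exact: derivable_comp dz ((GA i).2 _ Dz).
Qed.

Lemma perturb_dist f G H z M : X z -> 0 <= M ->
  (forall i w, normc w <= 1 -> normc (G i w - H i w) <= M) ->
  normc (perturb f G z - perturb f H z) <= N.+1%:R * M.
Proof.
move=> Xz M0 GH; rewrite /perturb opprD addrACA subrr add0r -sumrB.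
have := @normc_sum R 'I_N.+1 (index_enum 'I_N.+1)
  (fun i => G i (psi i z) - H i (psi i z)) M.
have -> : size (index_enum 'I_N.+1) = N.+1.
  by rewrite /index_enum -enumT size_enum_ord.
by apply => i; apply: GH; exact: psi_disc.
Qed.

(** Each stage adds to one of the [N + 1] disc algebra functions a perturbation
    serving one triple (component, slope, level); the amplitudes decrease fast
    enough for the later stages to stay within the tolerance left by each. *)
Lemma generic_perturbation f (e : R) : A_space W J f -> 0 < e ->
  exists F, [/\ A_space W J F, forall z, normc (F z - f z) <= e &
    forall i k m, (0 < k)%N -> (0 < m)%N ->
      D_class (L i) (K i m) k (fun w => complex.Re (F (Phi i w)))].
Proof.
move=> [fW fX fout] e0.
(* The stages after t move F by at most 4 (N + 1) C q^(t + 1), which this q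
   makes equal to the tolerance C q^t / 32 left by stage t. *)
pose q : R := (128 * N.+1%:R)^-1.
pose C : R := e / (4 * N.+1%:R).
have N0 : 1 <= N.+1%:R :> R by rewrite ler1n.
have q0 : 0 <= q by rewrite invr_ge0; lra.
have qN : 128 * N.+1%:R * q = 1 by rewrite divff //; lra.
have q01 : 0 <= q <= 1 / 2.
  rewrite q0 /=; have : 1 * q <= N.+1%:R * q by rewrite ler_wpM2r.
  by move: qN; rewrite -mulrA; lra.
have CN : 4 * N.+1%:R * C = e by rewrite /C mulrCA divff ?mulr1 //; lra.
have C0 : 0 < C by rewrite divr_gt0 //; lra.
have qp : 0 < q by rewrite invr_gt0; lra.
have Ct t : 0 < C * q ^+ t by rewrite mulr_gt0 ?exprn_gt0.
(* Slopes and levels are shifted by one, as only the positive ones occur. *)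
pose triple := ('I_N.+1 * nat * nat)%type.
pose dec (t : nat) : triple := odflt (ord0, 0%N, 0%N) (unpickle t).
pose good t (G : 'I_N.+1 -> R[i] -> R[i]) g :=
  let: (i, k, m) := dec t in
  [/\ disc_algebra g, taylor_bound (radius R t) (C * q ^+ t) g,
    forall z, normc z <= 1 -> normc (g z) <= C * q ^+ t &
    forall v : R[i] -> R,
      (forall z, K i m.+1 z -> `|v z - (complex.Re (perturb f G (Phi i z))
          + complex.Re (g z))| <= C * q ^+ t / 32) ->
      forall theta : R, K i m.+1 (expi theta) -> exists y : R,
        [/\ theta - k.+1%:R^-1 < y < theta + k.+1%:R^-1, K i m.+1 (expi y)
          & k.+1%:R * `|y - theta| < `|v (expi y) - v (expi theta)|]].
have /choice[next nextP] : forall p : nat * ('I_N.+1 -> R[i] -> R[i]),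
    exists g, (forall i, disc_algebra (p.2 i)) -> good p.1 p.2 g.
  case=> t G /=; have [GA|] := pselect (forall i, disc_algebra (G i));
    last by exists 0.
  rewrite /good; case: (dec t) => [[i k] m].
  have [|||||||g gP] := @oscillating_perturbation R (K i m.+1)
      (fun w => complex.Re (perturb f G (Phi i w))) k.+1 (C * q ^+ t)
      (radius R t).
  - exact: K_compact.
  - exact: K_circle.
  - exact: K_perfect.
  - have cP := within_comp (@Phi_in i) (@Phi_cont i) (perturb_within fX GA).
    exact: continuous_subspaceW (@K_L i m.+1 isT) (within_Re cP).
  - by [].
  - exact: Ct.
  - exact: radius_itv.
  by exists g.
pose G := fix G t : 'I_N.+1 -> R[i] -> R[i] := if t is s.+1
  then fun i => G s i + (if i == (dec s).1.1 then next (s, G s) else 0)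
  else fun _ => 0.
have GS t i : G t.+1 i =
  G t i + (if i == (dec t).1.1 then next (t, G t) else 0) by [].
have goodE t : (forall i, disc_algebra (G t i)) -> good t (G t) (next (t, G t)).
  by move=> /(nextP (t, G t)).
have nextA t : (forall i, disc_algebra (G t i)) -> disc_algebra (next (t, G t)).
  by move=> /goodE; rewrite /good; case: (dec t) => [[i k] m] [].
have GA t i : disc_algebra (G t i).
  elim: t i => [|t IH] i; first exact: disc_algebra0.
  rewrite GS; apply: disc_algebraD (IH i) _.
  by case: ifP => _; [exact: nextA|exact: disc_algebra0].
have Gnext t := goodE t (GA t).
have G1 t i z : normc z <= 1 -> normc (G t.+1 i z - G t i z) <= C * q ^+ t.
  move=> z1; rewrite GS -[(_ + _) z]/(G t i z + _ z) [G t i z + _]addrC addrK.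
  case: ifP => _; last first.
    by rewrite -[(0 : R[i] -> R[i]) z]/(0 : R[i]) Normc.normc0 ltW.
  by have := Gnext t; rewrite /good; case: (dec t) => [[j k] m] [_ _ + _]; apply.
have GT t i : taylor_bound (radius R t) (C * q ^+ t) (G t.+1 i - G t i).
  rewrite GS [G t i + _]addrC addrK; case: ifP => _.
    by have := Gnext t; rewrite /good; case: (dec t) => [[j k] m] [].
  by apply: taylor_bound0; exact/ltW.
have /choice[H HP] : forall i, exists H, disc_algebra H /\
    forall t z, normc z <= 1 -> normc (H z - G t i z) <= 4 * C * q ^+ t.
  move=> i; have [H HA HG] := @disc_algebra_limit R (fun t => G t i) C q
    (ltW C0) q01 (fun t => GA t i) (fun t => G1 t i) (fun t => GT t i).
  by exists H.
have HA i : disc_algebra (H i) by have [] := HP i.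
have HG t z : X z ->
    normc (perturb f H z - perturb f (G t) z) <= 4 * N.+1%:R * C * q ^+ t.
  move=> Xz; have -> : 4 * N.+1%:R * C * q ^+ t = N.+1%:R * (4 * C * q ^+ t).
    by ring.
  apply: perturb_dist => //; first by have := Ct t; lra.
  by move=> i w; have [_] := HP i; apply.
pose F := patch (cst 0) X (perturb f H).
have FE z : X z -> F z = perturb f H z by move=> Xz; rewrite /F patchT ?inE.
have FX : {within X, continuous F}.
  apply: (@subspace_eq_continuous _ X _ (perturb f H : subspace X -> _)).
    by move=> z /set_mem Xz; exact/esym/FE.
  exact: perturb_within.
have FW z (Wz : W z) : derivable F z 1.
  apply: (derivable_eq_open W_open Wz _ (perturb_derivable Wz (fW z Wz) HA)).
  by move=> w Ww; rewrite FE //; left.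
have Fout z : ~ X z -> F z = 0 by move=> nX; rewrite /F patchC ?inE.
exists F; split; first by split; [exact: FW|exact: FX|exact: Fout].
- move=> z; have [Xz|nX] := pselect (X z); last first.
    by rewrite Fout // fout // subrr Normc.normc0 ltW.
  have := HG 0%N z Xz; rewrite CN expr0 mulr1 FE //; congr (normc (_ - _) <= _).
  by rewrite /perturb big1 ?addr0.
move=> i k m k0 m0; split.
  exact: within_Re (within_comp (@Phi_in i) (@Phi_cont i) FX).
case: k k0 => // k _; case: m m0 => // m _.
pose t := pickle ((i, k, m) : triple).
have decE : dec t = (i, k, m) by rewrite /dec /t pickleK.
have := Gnext t; rewrite /good decE => -[_ _ _ gP].
apply: (gP (fun w => complex.Re (F (Phi i w)))) => w Kw.
have Lw : L i w := @K_L i m.+1 isT w Kw.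
have Xw := Phi_in Lw.
have -> : complex.Re (perturb f (G t) (Phi i w)) + complex.Re (next (t, G t) w)
    = complex.Re (perturb f (G t.+1) (Phi i w)).
  have Gi : G t.+1 i w = G t i w + next (t, G t) w by rewrite GS decE eqxx.
  have Gj j : j != i -> G t.+1 j = G t j.
    by move=> /negbTE ji; rewrite GS decE ji addr0.
  rewrite -ReD; congr complex.Re; rewrite /perturb -addrA; congr (_ + _).
  rewrite (bigD1 i isT) [RHS](bigD1 i isT) PhiK // Gi addrAC; congr (_ + _).
  by apply: eq_bigr => j /Gj ->.
rewrite FE // -ReB; apply: le_trans (normc_Re _) _.
apply: (le_trans (HG t.+1 _ Xw)).
have -> : 4 * N.+1%:R * C * q ^+ t.+1 = 128 * N.+1%:R * q * (C * q ^+ t) / 32.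
  by rewrite exprS; field.
by rewrite qN mul1r.
Qed.

End Construction.

(** * Components of the complement on the sphere *)

Section SphereTopology.
Variable R : realType.

Lemma closed_disc (M : R) : closed [set z : R[i] | normc z <= M].
Proof.
rewrite -openC openE => z /= /negP; rewrite -ltNge => zM.
apply/nbhs_planeP; exists (normc z - M); first by rewrite subr_gt0.
move=> y yz /=; apply/negP; rewrite -ltNge.
by have := normc_distD y z 0; rewrite !subr0 normc_distC; lra.
Qed.

Lemma boundary_closed {T : topologicalType} (A : set T) : closed (boundary A).
Proof.
rewrite /boundary setDE; apply: closedI; first exact: closed_closure.
by apply: open_closedC; exact: open_interior.
Qed.

Lemma boundary_open {T : topologicalType} (A : set T) :
  open A -> boundary A = closure A `\` A.
Proof. by move=> /interior_id oA; rewrite /boundary oA. Qed.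

Lemma within_preimage_closed (T U : topologicalType) (A : set T) (f : T -> U)
    (B : set U) : closed A -> {within A, continuous f} -> closed B ->
  closed (A `&` f @^-1` B).
Proof.
move=> cA /continuous_closedP cf cB; have := cf B cB.
by rewrite -(closed_setSI _ cA).
Qed.

Lemma edistC_ball_closed (r : R) (q : sphere R) : q <> None ->
  closed [set p | (r%:E <= edistC p q)%E].
Proof.
case: q => // z _.
have -> : [set p : sphere R | (r%:E <= edistC p (Some z))%E] =
    ~` (Some @` [set y : R[i] | normc (y - z) < r]).
  apply/seteqP; split=> [[y|] /= rp|[y|] /= np].
  - by move=> [x xz [xy]]; move: rp; rewrite -xy lee_fin leNgt xz.
  - by move=> [x _].
  - by rewrite lee_fin leNgt; apply/negP => yz; apply: np; exists y.
  - exact: leey.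
apply: open_closedC; apply: one_point_compactification_open_some.
rewrite openE => y /= yz; apply/nbhs_planeP.
exists (r - normc (y - z)); first by rewrite subr_gt0.
by move=> x xy; apply: (le_lt_trans (normc_distD y _ _)); lra.
Qed.

(** The part of [Delta_comp] lying on the arc is cut out of the boundary by
    closed conditions: a boundary point off the arc is at distance 0 from the
    set that it should stay away from. *)
Lemma level_arcE (A J : set (sphere R)) (m : nat) :
  ~ boundary A None -> J `<=` boundary A -> (0 < m)%N ->
  Delta_comp A J m `&` J = boundary A `&`
    \bigcap_(q in boundary A `\` J) [set p | ((m%:R^-1)%:E <= edistC p q)%E].
Proof.
move=> bN JA m0; have m1 : 0 < m%:R^-1 :> R by rewrite invr_gt0 ltr0n.
have inJ p : boundary A p -> (forall q, (boundary A `\` J) q ->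
    ((m%:R^-1)%:E <= edistC p q)%E) -> J p.
  move=> Ap far; apply: contrapT => nJ; have := far p (conj Ap nJ).
  case: p {nJ far} Ap => [z|//] _.
  by rewrite /= subrr Normc.normc0 lee_fin leNgt m1.
rewrite /Delta_comp; case: pselect => [A0|A1]; apply/seteqP; split => p.
- by move=> [_ Jp]; split; [exact: JA|rewrite A0].
- by move=> [Ap far]; split; [exact: Ap.1|exact: inJ].
- move=> [[_ far] Jp]; split; first exact: JA.
  move=> q Aq; apply: (le_trans far); apply: ereal_inf_lbound.
  by exists q.
- move=> [Ap far]; have Jp := inJ p Ap far; split=> //; split; first by right.
  by apply: le_ereal_inf_tmp => _ [q Aq <-]; exact: far.
Qed.

Lemma L_level_compact (A J : set (sphere R)) (phi : R[i] -> sphere R)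
    (m : nat) :
  ~ boundary A None -> J `<=` boundary A -> (0 < m)%N ->
  {within @closed_unit_disc R, continuous phi} ->
  compact (L_level phi A J m).
Proof.
move=> bN JA m0 cphi; apply: (@compact_plane R _ 1); last by move=> z [].
rewrite /L_level level_arcE //.
set B := boundary A `&` _; have cB : closed B.
  apply: closedI; first exact: boundary_closed.
  apply: closed_bigI => q Aq; apply: edistC_ball_closed => q0.
  by apply: bN; rewrite -q0; exact: Aq.1.
have cD : closed (@closed_unit_disc R) := @closed_disc 1.
exact: within_preimage_closed cD cphi cB.
Qed.

Lemma bounded_normc (A : set R[i]) : bounded_set A ->
  exists M : R, forall z, A z -> normc z <= M.
Proof.
move=> /pinfty_ex_gt0[[a b]]; rewrite ltcE /= => /andP[/eqP -> _] AM.
by exists a => z /AM /=; rewrite normE lecR.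
Qed.

Lemma nbhs_infty_bounded (A : set R[i]) : bounded_set A ->
  nbhs (None : sphere R) (~` to_sphere A).
Proof.
move=> /bounded_normc[M AM].
have cM := @closed_disc M.
exists [set z : R[i] | normc z <= M].
  by split; [exact: (compact_plane cM (fun z h => h))|exact: cM].
move=> p [[z /= zM <-]|->]; last by move=> [y _ yN].
by move=> [y Ay [yz]]; apply: zM; rewrite -yz; exact: AM.
Qed.

End SphereTopology.

Section Components.
Variables (R : realType) (Omega : set R[i]) (n : nat).
Variable V : 'I_n.+1 -> set (sphere R).
Hypothesis Omega_open : open Omega.
Hypothesis Omega_bounded : bounded_set Omega.
Hypothesis V_components : set_bij setT (components (~` to_sphere Omega)) V.
Hypothesis V_infty : V ord0 None.

Lemma V_component i : exists2 x, ~ to_sphere Omega x &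
  connected_component (~` to_sphere Omega) x = V i.
Proof. by have [VC _ _] := V_components; have [x ? ?] := VC i I; exists x. Qed.

Lemma V_closed i : closed (V i).
Proof.
have [x _ <-] := V_component i; apply: component_closed.
by apply: open_closedC; exact: one_point_compactification_open_some.
Qed.

Lemma V_inj i j p : V i p -> V j p -> i = j.
Proof.
have [_ Vinj _] := V_components.
have [x _ Ex] := V_component i; have [y _ Ey] := V_component j.
move=> Vi Vj; apply: Vinj; rewrite ?inE //.
rewrite -Ex in Vi; rewrite -Ey in Vj.
by rewrite -Ex -Ey (same_connected_component Vi) (same_connected_component Vj).
Qed.

Lemma V_out i z : Omega z -> ~ V i (Some z).
Proof.
move=> Oz; have [x _ <-] := V_component i.
by move=> /(@connected_component_sub _ (~` to_sphere Omega)); apply; exists z.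
Qed.

Lemma V_cover p : ~ to_sphere Omega p -> exists i, V i p.
Proof.
have [_ _ Vsurj] := V_components => Op.
have [|i _ Vi] := Vsurj (connected_component (~` to_sphere Omega) p).
  by exists p.
by exists i; rewrite Vi; exact: connected_component_refl.
Qed.

Lemma V_compl_open i : open (~` V i).
Proof. exact/closed_openC/V_closed. Qed.

Lemma boundary_compl_V i : boundary (~` V i) = closure (~` V i) `&` V i.
Proof. by rewrite (boundary_open (@V_compl_open i)) setDE setCK. Qed.

(** Infinity is interior to the unbounded component: a punctured neighbourhood
    of it avoids [Omega] and the other, closed, components. *)
Lemma boundary_infty i : ~ boundary (~` V i) None.
Proof.
rewrite boundary_compl_V => -[clN ViN]; have i0 : i = ord0 := V_inj ViN V_infty.
have : nbhs (None : sphere R) (V ord0).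
  have nVj j : nbhs (None : sphere R) [set p | j != ord0 -> (~` V j) p].
    have [->|j0] := eqVneq j ord0; first by apply: filterE => p /=.
    have nj : (~` V j) None.
      by move=> /V_inj/(_ V_infty)/eqP; rewrite (negbTE j0).
    by apply: filterS (open_nbhs_nbhs (conj (@V_compl_open j) nj)) => p ? _.
  have nV := @filter_forall _ _ _ _ (nbhs_filter (None : sphere R)) nVj.
  apply: filterS2 nV (nbhs_infty_bounded Omega_bounded) => p nV /V_cover[j Vj].
  by have [<-//|/nV] := eqVneq j ord0.
by rewrite -i0 => /clN[p []].
Qed.

End Components.

(** * Density *)

Section SphereMaps.
Variable R : realType.

Lemma within_from_sphere (X : set R[i]) (B : set (sphere R))
    (psi : sphere R -> R[i]) : (forall z, X z -> B (Some z)) ->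
  {within B, continuous psi} -> {within X, continuous (fun z => psi (Some z))}.
Proof.
move=> XB /subspace_continuousP cpsi; apply/within_planeP => z Xz e e0.
have ball_e : nbhs (psi (Some z)) [set y | normc (y - psi (Some z)) < e].
  by apply/nbhs_planeP; exists e.
have : nbhs z
    [set y : R[i] | B (Some y) -> normc (psi (Some y) - psi (Some z)) < e].
  exact: cpsi (Some z) (XB z Xz) _ ball_e.
move=> /nbhs_planeP[d d0 dP]; exists d => // y Xy yz.
exact: dP y yz (XB y Xy).
Qed.

Lemma within_finite_part (A : set R[i]) (phi : R[i] -> sphere R) :
  (forall w, A w -> phi w <> None) -> {within A, continuous phi} ->
  {within A, continuous (fun w => finite_part (phi w))}.
Proof.
move=> fin /subspace_continuousP cphi; apply/within_planeP => w Aw e e0.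
have nz : nbhs (phi w)
    [set p | normc (finite_part p - finite_part (phi w)) < e].
  have := fin w Aw; case: (phi w) => // z _.
  apply: (_ : nbhs z [set y : R[i] | normc (y - z) < e]).
  by apply/nbhs_planeP; exists e.
have /nbhs_planeP[d d0 dP] := cphi w Aw _ nz; exists d => // y Ay yw.
exact: dP y yw Ay.
Qed.

Lemma sup_seminorm_le (K : set R[i]) (f : R[i] -> R[i]) (M : R) :
  0 <= M -> (forall z, normc (f z) <= M) -> sup_seminorm K f <= M.
Proof.
move=> M0 fM; rewrite /sup_seminorm; set E := [set _ | _ in _].
have [->|/set0P[x Ex]] := eqVneq E set0; first by rewrite sup0.
by apply: ge_sup => [|_ [z _ <-]]; first by exists x.
Qed.

End SphereMaps.

Theorem lemma6p7 (R : realType) (Omega : set R[i]) (n : nat)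
    (V : 'I_n.+1 -> set (sphere R))
    (phi : 'I_n.+1 -> R[i] -> sphere R)
    (J : 'I_n.+1 -> set (sphere R))
    (Omega_domain : is_domain Omega)
    (Omega_bounded : bounded_set Omega)
    (Omega_jordan : bounded_by_jordan_curves Omega)
    (V_components : set_bij setT (components (~` to_sphere Omega)) V)
    (V_infty : V ord0 None)
    (phi_riemann : forall i, is_riemann_map (~` V i) (phi i))
    (J_open : forall i, relatively_open (boundary (~` V i)) (J i))
    (J_proper : exists i, J i <> boundary (~` V i))
    (L_level_perfect : forall i (m : nat), (0 < m)%N ->
       isolated (L_level (phi i) (~` V i) (J i) m) = set0) :
  let Jall : set R[i] := plane_part (\bigcup_i J i) in
  let Delta (m : nat) : set R[i] :=
    plane_part (\bigcap_i Delta_comp (~` V i) (J i) m) in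
  seminorm_dense (A_space Omega Jall)
    (fun m => sup_seminorm (Delta m))
    (\bigcap_(i in [set: 'I_n.+1])
       \bigcap_(k in [set k : nat | (0 < k)%N])
         \bigcap_(m in [set m : nat | (0 < m)%N])
           E_class Omega Jall (phi i) (~` V i) (J i) k m).
Proof.
move=> Jall Delta.
have [_ oO _] := Omega_domain.
have bN := boundary_infty oO Omega_bounded V_components V_infty.
have bE := boundary_compl_V oO V_components.
have V1 := V_inj V_components.
have JB i : J i `<=` boundary (~` V i).
  by have [U _ ->] := J_open i; move=> p [].
have JV i p : J i p -> V i p by move=> /JB; rewrite bE => -[].
have Jfin i p : J i p -> p <> None.
  by move=> /JB Bp p0; apply: (bN i); rewrite -p0.
have XC i z : (Omega `|` Jall) z -> closure (~` V i) (Some z).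
  move=> [Oz|[j _ Jz]].
    by apply: subset_closure; exact: (V_out V_components Oz).
  have [ij|ij] := eqVneq i j.
    by rewrite -ij in Jz; have /JB := Jz; rewrite bE => -[].
  apply: subset_closure => Vz; move/eqP: ij; apply.
  exact: V1 Vz (JV j _ Jz).
have /choice[psi psiP] := phi_riemann.
have homeo i :
    homeomorphism (@closed_unit_disc R) (closure (~` V i)) (phi i) (psi i).
  by have [] := psiP i.
have phi_cont i : {within @closed_unit_disc R, continuous (phi i)}.
  by have [_ _ _ ? _] := homeo i.
have psiK i w : closed_unit_disc w -> psi i (phi i w) = w.
  by have [_ _ [+ _] _ _] := homeo i; apply.
have disc_closed w : unit_disc w -> @closed_unit_disc R w by exact: ltW.
have phi_disc i w : unit_disc w -> ~ V i (phi i w).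
  move=> Dw; have [_ im _ _] := psiP i.
  suff : (~` V i) (phi i w) by []; by rewrite -im; exists w.
have psi_disc i p : ~ V i p -> unit_disc (psi i p).
  move=> nVp; have [_ im _ _] := psiP i.
  have : (phi i @` @unit_disc R) p by rewrite im.
  by move=> [w Dw <-]; rewrite psiK //; exact: disc_closed.
have L_fin i w : L_arc (phi i) (J i) w ->
    Some (finite_part (phi i w)) = phi i w :> sphere R.
  by move=> [_ /Jfin]; case: (phi i w).
have L_closed i : L_arc (phi i) (J i) `<=` @closed_unit_disc R by move=> w [].
have K_L i m : (0 < m)%N ->
    L_level (phi i) (~` V i) (J i) m `<=` L_arc (phi i) (J i).
  by move=> _ w [Dw [_ Jw]].
have approx f e : A_space Omega Jall f -> 0 < e -> exists F,
    [/\ A_space Omega Jall F, forall z, Normc.normc (F z - f z) <= e &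
    forall i k m, (0 < k)%N -> (0 < m)%N ->
      D_class (L_arc (phi i) (J i)) (L_level (phi i) (~` V i) (J i) m) k
        (fun w => complex.Re (F (finite_part (phi i w))))].
  apply: (@generic_perturbation R n Omega Jall (fun i z => psi i (Some z))
    (fun i w => finite_part (phi i w)) (fun i => L_arc (phi i) (J i))
    (fun i m => L_level (phi i) (~` V i) (J i) m)) => //.
  - move=> i; apply: (within_from_sphere (XC i)).
    by have [_ _ _ _ ?] := homeo i.
  - by move=> i z /(XC i) Bz; have [_ h _ _ _] := homeo i; exact: h.
  - move=> i z Oz; have nVz := V_out V_components (i := i) Oz.
    split; first exact: psi_disc.
    by have [_ _ _ +] := psiP i; move=> /(_ (Some z) nVz).
  - move=> i; apply: within_finite_part; first by move=> w [_ /Jfin].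
    exact: continuous_subspaceW (L_closed i) (phi_cont i).
  - move=> i w Lw; right; exists i => //.
    by rewrite (L_fin i w Lw); have [] := Lw.
  - by move=> i w Lw; rewrite (L_fin i w Lw) psiK //; have [] := Lw.
  - move=> i m m0 w Lw; have [Dw Jw] := K_L i m m0 w Lw.
    apply/eqP; rewrite eq_le Dw /= leNgt; apply/negP => /phi_disc.
    by move=> /(_ i); apply; exact: JV.
  - by move=> i m m0; apply: L_level_compact.
split=> [f Sf|U [UA Uopen] [f Uf]].
  by have [] := Sf ord0 I 1%N isT 1%N isT.
have [N [e e0 eU]] := Uopen f Uf.
have e2 : 0 < e / 2 by rewrite divr_gt0.
have [F [FA Ff FD]] := approx f (e / 2) (UA f Uf) e2.
exists F; split; last by move=> i _ k k0 m m0; split; [exact: FA|exact: FD].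
apply: eU => // m _; apply: (@le_lt_trans _ _ (e / 2)).
  by apply: sup_seminorm_le; [exact: ltW|exact: Ff].
by rewrite ltr_pdivrMr // ltr_pMr // ltr1n.
Qed.
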